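(* Let $\lambda\in\mathbb{R}$. For every integer $p\ge 0$ and all real $x$ with $|x|<1$, \[ \Big(x\frac{d}{dx}\Big)_{p,\lambda}\frac{1}{1-x}=\sum_{n=0}^{\infty}(n)_{p,\lambda}x^n=\frac{1}{1-x}F_{p,\lambda}\Big(\frac{x}{1-x}\Big). \] In addition, for every positive integer $p$ and all real $x$ with $|x|<1$, \[ \sum_{n=1}^{\infty}\Big((1)_{p,\lambda}+(2)_{p,\lambda}+\cdots+(n)_{p,\lambda}\Big)x^n=\frac{1}{(1-x)^2}F_{p,\lambda}\Big(\frac{x}{1-x}\Big). \]
   Context: For $\lambda\in\mathbb{R}$, the generalized falling factorials are $(x)_{0,\lambda}=1$ and $(x)_{n,\lambda}=x(x-\lambda)(x-2\lambda)\cdots(x-(n-1)\lambda)$ for $n\ge 1$. The degenerate differential operator is $\big(x\frac{d}{dx}\big)_{0,\lambda}=\mathrm{id}$ and $\big(x\frac{d}{dx}\big)_{n,\lambda}=\big(x\frac{d}{dx}\big)\big(x\frac{d}{dx}-\lambda\big)\cdots\big(x\frac{d}{dx}-(n-1)\lambda\big)$ for $n\ge1$. The degenerate exponential is the formal power series $e_\lambda(t)=\sum_{n\ge 0}(1)_{n,\lambda}\frac{t^n}{n!}$. The degenerate Fubini polynomials $F_{n,\lambda}(x)$ are defined by $\frac{1}{1-x(e_\lambda(t)-1)}=\sum_{n=0}^{\infty}F_{n,\lambda}(x)\frac{t^n}{n!}$ (as formal power series in $t$). *)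

(* Defs.v *)
From HB Require Import structures.
From mathcomp Require Import all_boot all_order all_algebra.
From mathcomp Require Import all_classical all_reals all_analysis.
Set Implicit Arguments.
Unset Strict Implicit.
Unset Printing Implicit Defensive.
Import Order.TTheory GRing.Theory Num.Theory.
Import numFieldNormedType.Exports.
Local Open Scope ring_scope.

(** Formal power series over [A], as coefficient sequences.  The pointwise
    product and unit that functions [nat -> A] inherit from the library are not
    those of power series, hence the dedicated operations below. *)
Section FormalPowerSeries.
Variable A : comUnitRingType.

Definition fps := nat -> A.

Definition fps_one : fps := fun n => (n == 0)%:R.

Definition fps_sub (a b : fps) : fps := fun n => a n - b n.

Definition fps_scale (c : A) (a : fps) : fps := fun n => c * a n.

Definition fps_mul (a b : fps) : fps :=
  fun n => \sum_(i < n.+1) a (n - i)%N * b i.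

(** The first [n] coefficients of [1 / a], obtained by solving
    [\sum_(i <= m) a (m - i) * b i = (m == 0)] successively for [b m]; this is
    meaningful when [a 0] is a unit, see [fps_mulV]. *)
Fixpoint fps_inv_prefix (a : fps) (n : nat) : seq A :=
  if n is m.+1 then
    let s := fps_inv_prefix a m in
    rcons s ((a 0)^-1 * ((m == 0)%:R - \sum_(i < m) a (m - i)%N * s`_i))
  else [::].

Definition fps_inv (a : fps) : fps := fun n => (fps_inv_prefix a n.+1)`_n.

Lemma size_fps_inv_prefix a n : size (fps_inv_prefix a n) = n.
Proof. by elim: n => //= n IHn; rewrite size_rcons IHn. Qed.

Lemma nth_fps_inv_prefix a n i :
  (i < n)%N -> (fps_inv_prefix a n)`_i = fps_inv a i.
Proof.
elim: n => // n IHn; rewrite ltnS leq_eqVlt => /orP[/eqP -> //|lt_in].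
by rewrite /= nth_rcons size_fps_inv_prefix lt_in IHn.
Qed.

Lemma fps_invE a n : fps_inv a n =
  (a 0)^-1 * ((n == 0)%:R - \sum_(i < n) a (n - i)%N * fps_inv a i).
Proof.
rewrite {1}/fps_inv /= nth_rcons size_fps_inv_prefix ltnn eqxx.
by congr (_ * (_ - _)); apply: eq_bigr => i _; rewrite nth_fps_inv_prefix.
Qed.

Lemma fps_mulV a : a 0 \is a GRing.unit -> fps_mul a (fps_inv a) =1 fps_one.
Proof.
move=> a0U n; rewrite /fps_mul big_ord_recr /= subnn fps_invE mulrA divrr //.
by rewrite mul1r addrC subrK.
Qed.

End FormalPowerSeries.

Section Degenerate.
Variables (R : realType) (lambda : R).

(** [(x)_{n,lambda}] *)
Definition degen_ffact (x : R) (n : nat) : R :=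
  \prod_(i < n) (x - i%:R * lambda).

(** [x d/dx] *)
Definition euler_op (f : R -> R) : R -> R := fun x => x * derive1 f x.

(** [(x d/dx)_{n,lambda}]: as in the left-to-right product of operators, the
    factor [x d/dx - (n-1) lambda] is the first one to act on [f]. *)
Fixpoint degen_euler_op (n : nat) (f : R -> R) : R -> R :=
  if n is m.+1 then
    degen_euler_op m (fun x => euler_op f x - m%:R * lambda * f x)
  else f.

(** [e_lambda(t)], with its coefficients seen as constants of [{poly R}] *)
Definition degen_exp : fps {poly R} :=
  fun n => (degen_ffact 1 n / n`!%:R)%:P.

(** [1 - x (e_lambda(t) - 1)], a power series in [t] over [R[x]] *)
Definition degen_fubini_den : fps {poly R} :=
  fps_sub (fps_one _)
    (fps_scale 'X (fps_sub degen_exp (fps_one _))).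

Definition degen_fubini (n : nat) : {poly R} :=
  n`!%:R *: fps_inv degen_fubini_den n.

Lemma degen_fubini_den0 : degen_fubini_den 0 = 1.
Proof.
rewrite /degen_fubini_den /fps_sub /fps_scale /degen_exp /fps_one /degen_ffact.
by rewrite big_ord0 fact0 divr1 subrr mulr0 subr0.
Qed.

Lemma degen_fubini_genfun :
  fps_mul degen_fubini_den (fun n => (n`!%:R)^-1 *: degen_fubini n)
    =1 fps_one _.
Proof.
have nfact n : n`!%:R != 0 :> R by rewrite pnatr_eq0 -lt0n fact_gt0.
move=> n; rewrite -[RHS](@fps_mulV _ degen_fubini_den) ?degen_fubini_den0 ?unitr1//.
by apply: eq_bigr => i _; rewrite /degen_fubini scalerA mulVf// scale1r.
Qed.

End Degenerate.

(* Main.v *)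
(** By the degenerate Vandermonde identity,
    [(n+1)_p = \sum_(i <= p) 'C(p, i) (1)_(p-i) (n)_i].  Hence the partial sums
    [u_N] of [\sum (n)_p x^n] satisfy [u_(N+1) = x u_N + b_N], where [b_N]
    involves only the series of lower index.  For [|x| < 1] such a recurrence
    gives convergence and a relation between the limits [G_p] which, for
    [(1 - x) G_p], is the recurrence of the Fubini polynomials at [x / (1 - x)].
    The series can be differentiated termwise, which yields the operator
    form.  The second formula follows from [A_(N+1) = x A_N + u_(N+1)] for the
    partial sums [A_N] of the series with coefficients [(1)_p + ... + (n)_p]. *)
Require Import Defs.
From HB Require Import structures.
From mathcomp Require Import all_boot all_order all_algebra.
From mathcomp Require Import all_classical all_reals all_analysis.
From mathcomp Require Import ring lra.
Set Implicit Arguments.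
Unset Strict Implicit.
Unset Printing Implicit Defensive.
Import Order.TTheory GRing.Theory Num.Theory.
Import numFieldNormedType.Exports.
Local Open Scope classical_set_scope.
Local Open Scope ring_scope.

(** * Affine recurrences with ratio of modulus less than 1 *)

Section Recurrence.
Variable R : realType.

(** The error [d N] to the fixed point obeys [d N.+1 = x * d N + (l - b N)]: a contraction with a
    vanishing perturbation. *)
Lemma cvg_affine_rec (u b : nat -> R) (x l : R) : `|x| < 1 ->
  (forall N, u N.+1 = x * u N + b N) -> b @ \oo --> l ->
  u @ \oo --> l / (1 - x).
Proof.
move=> x1 uS bl.
have x1' : 0 < 1 - `|x| by rewrite subr_gt0.
have xN1 : 1 - x != 0 by rewrite subr_eq0 eq_sym lt_eqF// ltr_normlW.
pose d N := l / (1 - x) - u N.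
have dS N : d N.+1 = x * d N + (l - b N) by rewrite /d uS; field.
apply/cvgrPdist_lt => e e0.
(* With this tolerance the perturbations add up, as a geometric sum, to at most [e / 2]. *)
move/cvgrPdist_lt: bl => /(_ (e / 2 * (1 - `|x|))) [].
  by rewrite mulr_gt0// divr_gt0.
move=> M _ bM.
have dM j : `|d (j + M)%N| <= `|d M| * `|x| ^+ j + e / 2 * (1 - `|x| ^+ j).
  elim: j => [|j IHj]; first by rewrite add0n expr0 subrr mulr0 mulr1 addr0.
  rewrite addSn dS (le_trans (ler_normD _ _))// normrM.
  have /ltW bj := bM (j + M)%N (leq_addl _ _).
  have {}IHj := ler_wpM2l (normr_ge0 x) IHj.
  rewrite (le_trans (lerD IHj bj))// exprS.
  by rewrite le_eqVlt; apply/orP; left; apply/eqP; ring.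
have /cvgrPdist_lt : geometric `|d M| `|x| @ \oo --> (0 : R).
  by apply: cvg_geometric; rewrite normr_id.
move=> /(_ (e / 2)) []; first by rewrite divr_gt0.
move=> K _ HK; exists (K + M)%N => // n /= KMn.
have Mn : (M <= n)%N by apply: leq_trans KMn; rewrite leq_addl.
rewrite -/(d n) -(subnK Mn) (le_lt_trans (dM _))//.
have Kn : (K <= n - M)%N by rewrite leq_subRL// addnC.
have := HK _ Kn; rewrite /= sub0r normrN normrM normrX !normr_id => h.
have : e / 2 * (1 - `|x| ^+ (n - M)) <= e / 2.
  apply: ler_piMr; first by rewrite ltW// divr_gt0.
  by rewrite gerBl exprn_ge0.
by move: h; set A := _ * _ ^+ _; set B := _ * (_ - _); lra.
Qed.

End Recurrence.

(** * Falling factorials and the degenerate Vandermonde identity *)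

Section FallingFactorial.
Variables (R : realType) (lambda : R).
Local Notation ff := (degen_ffact lambda).

Lemma degen_ffact0 (x : R) : ff x 0 = 1.
Proof. by rewrite /degen_ffact big_ord0. Qed.

Lemma degen_ffactSr (x : R) n : ff x n.+1 = ff x n * (x - n%:R * lambda).
Proof. by rewrite /degen_ffact big_ord_recr. Qed.

Lemma degen_ffactSl (x : R) n : ff x n.+1 = x * ff (x - lambda) n.
Proof.
rewrite /degen_ffact big_ord_recl mul0r subr0; congr (_ * _).
by apply: eq_bigr => i _; rewrite /= /bump leq0n add1n -natr1; ring.
Qed.

Lemma degen_ffact0n n : ff 0 n = (n == 0)%:R.
Proof. by case: n => [|n]; rewrite ?degen_ffact0// degen_ffactSl mul0r. Qed.

Lemma degen_ffactD (x y : R) n :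
  ff (x + y) n = \sum_(i < n.+1) 'C(n, i)%:R * ff x (n - i)%N * ff y i.
Proof.
elim: n => [|n IHn].
  by rewrite big_ord1 subnn !degen_ffact0 bin0 !mulr1.
rewrite degen_ffactSr {}IHn mulr_suml.
(* The new factor splits as [(x - (n - i) lambda) + (y - i lambda)], each part extending one falling
   factorial; Pascal's rule then recombines the sums. *)
have step (i : 'I_n.+1) :
    'C(n, i)%:R * ff x (n - i) * ff y i * (x + y - n%:R * lambda) =
    'C(n, i)%:R * ff x (n.+1 - i)%N * ff y i
    + 'C(n, i)%:R * ff x (n - i)%N * ff y i.+1.
  have in_ : (i <= n)%N by rewrite -ltnS.
  rewrite subSn// !degen_ffactSr natrB//; ring.
under eq_bigr do rewrite step.
rewrite big_split/= big_ord_recl [X in _ + X]big_ord_recr/=.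
rewrite [in RHS]big_ord_recl [in X in _ = _ + X]big_ord_recr/=.
rewrite !bin0 !binn !subnn /= -!addrA; congr (_ + _).
rewrite addrA; congr (_ + _).
rewrite -big_split/=; apply: eq_bigr => i _.
by rewrite /bump leq0n !add1n binS natrD subSS; ring.
Qed.

End FallingFactorial.

(** * Recurrence for the degenerate Fubini polynomials *)

Section Fubini.
Variables (R : realType) (lambda : R).

(** Compare the coefficients of [t^p] in denominator times generating function equals 1; the term
    [i = p] can be isolated because the denominator has constant coefficient 1. *)
Lemma degen_fubiniE p : degen_fubini lambda p =
  (p == 0)%:R + 'X * \sum_(i < p)
    ('C(p, i)%:R * degen_ffact lambda 1 (p - i)%N) *: degen_fubini lambda i.
Proof.
have nfact n : n`!%:R != 0 :> R by rewrite pnatr_eq0 -lt0n fact_gt0.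
have := degen_fubini_genfun lambda p; rewrite /fps_mul big_ord_recr/= subnn.
rewrite degen_fubini_den0 mul1r => /(canRL (addKr _)) H.
have -> : degen_fubini lambda p =
    p`!%:R *: ((p`!%:R)^-1 *: degen_fubini lambda p).
  by rewrite scalerA mulfV// scale1r.
rewrite {}H scalerDr addrC; congr (_ + _).
  by rewrite /fps_one; case: p => [|p]; rewrite /= ?scale1r// scaler0.
rewrite -sumrN scaler_sumr mulr_sumr; apply: eq_bigr => i _.
rewrite /degen_fubini_den /fps_sub /fps_scale /degen_exp /fps_one.
have /negPf -> : (p - i != 0)%N by rewrite subn_eq0 -ltnNge.
rewrite sub0r subr0 -mul_polyC -!mul_polyC.
have <- : p`!%:R / ((p - i)`!%:R * i`!%:R) = 'C(p, i)%:R :> R.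
  rewrite -(bin_fact (ltnW (ltn_ord i))) !natrM.
  by field; rewrite !nfact.
rewrite invfM !polyCM; ring.
Qed.

End Fubini.

(** * Convergence and sums of the falling factorial series *)

Section FallingFactorialSeries.
Variables (R : realType) (lambda : R).
Local Notation ff := (degen_ffact lambda).
Local Notation S a p := (pseries (fun n => ff (n%:R + a) p)).

(** Peel off the term of index 0 and expand [((n + a) + 1)_p] by Vandermonde; the top term gives
    [x * S a p x N]. The shift [a] is kept general for the differentiated series. *)
Lemma pseries_ffactS a p x N : S a p x N.+1 = x * S a p x N +
  (ff a p + x * \sum_(i < p) 'C(p, i)%:R * ff 1 (p - i)%N * S a i x N).
Proof.
have step i : ff (i.+1%:R + a) p * x ^+ i.+1 = x * (ff (i%:R + a) p * x ^+ i)
    + x * \sum_(j < p) 'C(p, j)%:R * ff 1 (p - j)%N * (ff (i%:R + a) j * x ^+ i).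
  rewrite -natr1 addrAC [_ + 1]addrC degen_ffactD big_ord_recr/=.
  rewrite subnn binn degen_ffact0 !mul1r mulrDl [LHS]addrC exprS.
  congr (_ + _); first by ring.
  by rewrite mulr_suml mulr_sumr; apply: eq_bigr => j _; ring.
rewrite /pseries /series/= big_nat_recl//= expr0 mulr1 add0r.
under eq_bigr do rewrite step.
rewrite big_split/= -!mulr_sumr exchange_big/= addrCA; congr (_ + (_ + _ * _)).
by apply: eq_bigr => j _; rewrite mulr_sumr.
Qed.

(** Leaving the lower limits [g] free serves both bare convergence and the Fubini closed form. *)
Lemma cvg_pseries_ffact_rec a x p (g : nat -> R) : `|x| < 1 ->
  (forall i, (i < p)%N -> S a i x @ \oo --> g i) ->
  S a p x @ \oo -->
  (ff a p + x * \sum_(i < p) 'C(p, i)%:R * ff 1 (p - i)%N * g i) / (1 - x).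
Proof.
move=> x1 gp; apply: cvg_affine_rec (pseries_ffactS a p x) _ => //.
apply: cvgD; first exact: cvg_cst.
apply: cvgMl_tmp; apply: cvg_big; first exact: add_continuous.
by move=> i _; exact: cvgMl_tmp (gp _ _).
Qed.

Lemma is_cvg_pseries_ffact a p x : `|x| < 1 -> cvgn (S a p x).
Proof.
move=> x1; elim/ltn_ind: p => p IHp; apply/cvg_ex; eexists.
by apply: (@cvg_pseries_ffact_rec _ _ _ (fun i => limn (S a i x))).
Qed.

Lemma cvg_pseries_ffact_fubini p x : `|x| < 1 ->
  S 0 p x @ \oo --> 1 / (1 - x) * (degen_fubini lambda p).[x / (1 - x)].
Proof.
move=> x1; elim/ltn_ind: p => p IHp.
pose g i := 1 / (1 - x) * (degen_fubini lambda i).[x / (1 - x)].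
(* It remains to see that the closed form satisfies the recurrence of the limits. *)
suff -> : 1 / (1 - x) * (degen_fubini lambda p).[x / (1 - x)] = (ff 0 p +
    x * \sum_(i < p) 'C(p, i)%:R * ff 1 (p - i)%N * g i) / (1 - x).
  exact: cvg_pseries_ffact_rec.
rewrite degen_fubiniE degen_ffact0n !hornerE horner_sum.
have -> : ((p == 0)%:R : {poly R}).[x / (1 - x)] = (p == 0)%:R.
  by case: (p == 0); rewrite ?hornerC.
rewrite [LHS]mulrC -[x / _ * _]mulrA; congr ((_ + _ * _) / _).
by rewrite mulr_sumr; apply: eq_bigr => i _; rewrite hornerZ /g div1r; ring.
Qed.

(** Write [n + 1] as [(n + b - p lambda) + (1 - b + p lambda)]: the first summand raises the order
    of the falling factorial, the second is constant. *)
Lemma is_cvg_pseries_natM_ffact b p x : `|x| < 1 ->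
  cvgn (pseries (fun n => n.+1%:R * ff (n%:R + b) p) x).
Proof.
move=> x1.
have -> : pseries (fun n => n.+1%:R * ff (n%:R + b) p) x =
    S b p.+1 x + (1 - b + p%:R * lambda) *: S b p x.
  apply/funext => N; rewrite /pseries /series/= fctE/=.
  rewrite [X in _ = _ + X]mulr_sumr -big_split/=.
  by apply: eq_bigr => n _; rewrite degen_ffactSr -natr1; ring.
apply: is_cvgD; first exact: is_cvg_pseries_ffact.
by apply: is_cvgZl_tmp; exact: is_cvg_pseries_ffact.
Qed.

End FallingFactorialSeries.

(** * Termwise action of the Euler operator *)

Section EulerOperator.
Variable R : realType.

Lemma eq_euler_op (f g : R -> R) (x : R) :
  (\forall y \near x, f y = g y) -> euler_op f x = euler_op g x.
Proof.
by move=> fg; rewrite /euler_op !derive1E (near_eq_derive _ fg).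
Qed.

Lemma near_norm_lt1 (x : R) : `|x| < 1 -> \forall y \near x, `|y| < 1.
Proof.
by move=> x1; exact: (cvgr_lt `|x| (@norm_continuous _ R x) 1 x1).
Qed.

Lemma cvg_pseries_euler_op (c : nat -> R) (f : R -> R) (x : R) :
  (forall y, `|y| < 1 -> pseries c y @ \oo --> f y) ->
  (forall y, `|y| < 1 -> cvgn (pseries (pseries_diffs c) y)) ->
  (forall y, `|y| < 1 -> cvgn (pseries (pseries_diffs (pseries_diffs c)) y)) ->
  `|x| < 1 -> pseries (fun n => n%:R * c n) x @ \oo --> euler_op f x.
Proof.
move=> cf c1 c2 x1.
(* Termwise differentiation at [x] asks for convergence at a point of larger modulus; the midpoint
   of [|x|] and 1 is still in the disc. *)
pose K := (1 + `|x|) / 2.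
have x0 := normr_ge0 x.
have K0 : 0 <= K by rewrite /K; lra.
have Kx : `|x| < `|K| by rewrite (ger0_norm K0) /K; lra.
have K1 : `|K| < 1 by rewrite (ger0_norm K0) /K; lra.
have dc := pseries_snd_diffs (cvgP _ (cf K K1)) (c1 K K1) (c2 K K1) Kx.
have -> : euler_op f x = x * limn (pseries (pseries_diffs c) x).
  (* [f] is the sum of the series only for [|y| < 1], which suffices since the derivative is
     local. *)
  rewrite (@eq_euler_op _ (fun y => limn (pseries c y))); last first.
    by apply: filterS (near_norm_lt1 x1) => y y1; apply/esym/cvg_lim => //; exact: cf.
  by rewrite /euler_op derive1E; congr (_ * _); exact: derive_val.
rewrite -cvg_shiftS.
have -> : [sequence pseries (fun n => n%:R * c n) x N.+1]_N =
    (fun N => x * pseries (pseries_diffs c) x N).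
  apply/funext => N; rewrite /pseries /series/= big_nat_recl//= !mul0r add0r.
  by rewrite mulr_sumr; apply: eq_bigr => n _; rewrite /pseries_diffs exprS; ring.
by apply: cvgMl_tmp; exact: c1.
Qed.

End EulerOperator.

(** * Iteration to the degenerate Euler operator *)

Section DegenerateEulerOperator.
Variables (R : realType) (lambda : R).
Local Notation ff := (degen_ffact lambda).

(* [x d/dx - m lambda] multiplies the [n]-th coefficient by [n - m lambda], and
   [(n - m lambda) (n - (m+1) lambda)_k = (n - m lambda)_(k+1)]; hence the
   shifted coefficients in the hypothesis. *)
Lemma cvg_pseries_degen_euler_op m k (f : R -> R) (x : R) : `|x| < 1 ->
  (forall y, `|y| < 1 ->
     pseries (fun n => ff (n%:R - m%:R * lambda) k) y @ \oo --> f y) ->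
  pseries (fun n => ff n%:R (m + k)%N) x @ \oo --> degen_euler_op lambda m f x.
Proof.
move=> x1; elim: m k f => [|m IHm] k f cf.
  have := cf x x1; rewrite mul0r.
  by under eq_fun do rewrite subr0.
rewrite addSnnS; apply: IHm => y y1.
set a := - (m.+1%:R * lambda) in cf.
have diffsE : pseries_diffs (fun n => ff (n%:R + a) k) =
    (fun n => n.+1%:R * ff (n%:R + (1 + a)) k).
  by apply/funext => n; rewrite /pseries_diffs -natr1 addrA.
(* The extra factor [n + 2] is [(n + 2 + a - k lambda) + (k lambda - a)], so only the factor [n + 1]
   is left. *)
have ddiffsE : pseries_diffs (pseries_diffs (fun n => ff (n%:R + a) k)) =
    (fun n => n.+1%:R * ff (n%:R + (2 + a)) k.+1
              + (k%:R * lambda - a) * (n.+1%:R * ff (n%:R + (2 + a)) k)).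
  apply/funext => n; rewrite diffsE /pseries_diffs degen_ffactSr.
  rewrite (_ : n.+1%:R + (1 + a) = n%:R + (2 + a)); last by rewrite -natr1; ring.
  by rewrite -!natr1; ring.
have c1 z : `|z| < 1 -> cvgn (pseries (pseries_diffs (fun n => ff (n%:R + a) k)) z).
  by rewrite diffsE; exact: is_cvg_pseries_natM_ffact.
have c2 z : `|z| < 1 ->
    cvgn (pseries (pseries_diffs (pseries_diffs (fun n => ff (n%:R + a) k))) z).
  move=> z1; rewrite ddiffsE.
  have -> : pseries (fun n => n.+1%:R * ff (n%:R + (2 + a)) k.+1
      + (k%:R * lambda - a) * (n.+1%:R * ff (n%:R + (2 + a)) k)) z =
    pseries (fun n => n.+1%:R * ff (n%:R + (2 + a)) k.+1) z
    + (k%:R * lambda - a) *: pseries (fun n => n.+1%:R * ff (n%:R + (2 + a)) k) z.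
    apply/funext => N; rewrite /pseries /series/= fctE/=.
    rewrite [X in _ = _ + X]mulr_sumr -big_split/=.
    by apply: eq_bigr => n _; ring.
  apply: is_cvgD; first exact: is_cvg_pseries_natM_ffact.
  by apply: is_cvgZl_tmp; exact: is_cvg_pseries_natM_ffact.
have -> : pseries (fun n => ff (n%:R - m%:R * lambda) k.+1) y =
    (fun N => pseries (fun n => n%:R * ff (n%:R + a) k) y N
              - m%:R * lambda * pseries (fun n => ff (n%:R + a) k) y N).
  apply/funext => N; rewrite /pseries /series/= mulr_sumr -sumrB.
  apply: eq_bigr => n _; rewrite degen_ffactSl.
  rewrite (_ : n%:R - m%:R * lambda - lambda = n%:R + a); first by ring.
  by rewrite /a -natr1; ring.
exact: cvgB (cvg_pseries_euler_op cf c1 c2 y1) (cvgMl_tmp (cf y y1)).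
Qed.

Lemma cvg_pseries_ffact_degen_euler_op p (x : R) : `|x| < 1 ->
  pseries (fun n => ff n%:R p) x @ \oo -->
  degen_euler_op lambda p (fun y => 1 / (1 - y)) x.
Proof.
(* At [k = 0] every coefficient is 1, whatever the shift: this is the geometric series. *)
move=> x1; rewrite -{1}[p]addn0; apply: cvg_pseries_degen_euler_op => // y y1.
have := @cvg_geometric_series R 1 y y1.
by under [X in _ -> pseries X _ @ _ --> _]eq_fun do rewrite degen_ffact0.
Qed.

End DegenerateEulerOperator.

Theorem theorem8 (R : realType) (lambda : R) :
  (forall (p : nat) (x : R), `|x| < 1 ->
     (fun N : nat => \sum_(0 <= n < N) degen_ffact lambda n%:R p * x ^+ n)
       @ \oo --> degen_euler_op lambda p (fun y : R => 1 / (1 - y)) x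
     /\
     (fun N : nat => \sum_(0 <= n < N) degen_ffact lambda n%:R p * x ^+ n)
       @ \oo --> 1 / (1 - x) * (degen_fubini lambda p).[x / (1 - x)])
  /\
  (forall (p : nat) (x : R), (0 < p)%N -> `|x| < 1 ->
     (fun N : nat => \sum_(1 <= n < N)
       (\sum_(1 <= k < n.+1) degen_ffact lambda k%:R p) * x ^+ n)
       @ \oo --> 1 / (1 - x) ^+ 2 * (degen_fubini lambda p).[x / (1 - x)]).
Proof.
have fubini (p : nat) (x : R) : `|x| < 1 ->
    pseries (fun n => degen_ffact lambda n%:R p) x @ \oo -->
    1 / (1 - x) * (degen_fubini lambda p).[x / (1 - x)].
  move=> x1; have := @cvg_pseries_ffact_fubini R lambda p x x1.
  by under eq_fun do rewrite addr0.
split=> p x; first by split; [exact: cvg_pseries_ffact_degen_euler_op|exact: fubini].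
move=> p0 x1; set u := fun N : nat => _.
(* As [p > 0], [(0)_p] vanishes, so both the inner and the outer sum may start at 0. *)
have s1 n : \sum_(1 <= k < n.+1) degen_ffact lambda k%:R p =
    \sum_(0 <= k < n.+1) degen_ffact lambda k%:R p.
  by rewrite [RHS]big_ltn// degen_ffact0n eqn0Ngt p0 add0r.
have uE N : u N = \sum_(0 <= n < N)
    (\sum_(0 <= k < n.+1) degen_ffact lambda k%:R p) * x ^+ n.
  rewrite /u; under eq_bigr do rewrite s1.
  case: N => [|N]; first by rewrite !big_geq.
  by rewrite [RHS]big_ltn// big_nat1 degen_ffact0n eqn0Ngt p0 mul0r add0r.
have -> : 1 / (1 - x) ^+ 2 * (degen_fubini lambda p).[x / (1 - x)] =
    1 / (1 - x) * (degen_fubini lambda p).[x / (1 - x)] / (1 - x).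
  by rewrite expr2 !div1r invfM mulrAC.
(* The forcing term at [N] is the partial sum with [N.+1] terms, hence the shift. *)
have := fubini p x x1; rewrite -cvg_shiftS; apply: cvg_affine_rec => // N.
rewrite !uE big_nat_recl//= expr0 mulr1 big_nat1.
under eq_bigr do rewrite big_nat_recr//= mulrDl.
rewrite big_split/= /pseries /series/= [in RHS]big_nat_recl//= expr0 mulr1.
rewrite addrCA; congr (_ + _).
by rewrite mulr_sumr; apply: eq_bigr => n _; rewrite exprS; ring.
Qed.
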